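(* Let $\mathcal A=(Q,\{a,b\},\delta)$ be an automaton in which $a$ is of type $[1,2]\backslash 1$ (with $1,2$ distinct states) and $b$ is of type $[x,y]\backslash z$ with $zb=x$ (with $x,y,z$ distinct states, not necessarily different from $1,2$). Then $\mathcal A$ is proper and $3$-compressible if and only if all of the following conditions hold: (1) if $b=[x,y]\backslash 1$ (that is, $z=1$), then $Orb_a(x)\not\subseteq\{x,y\}$; (2) if $z=2$ and (2a) $b=[1,y]\backslash 2$ (that is, $x=1$), then $Orb_a(2)\not\subseteq\{2,y\}$ or $2ab\notin\{1,y\}$; (2b) $b=[x,1]\backslash 2$ (that is, $y=1$), then $\{2a,xa\}\ne\{2,x\}$ or $\{2ab,xab\}\ne\{1,x\}$; (2c) $b=[x,y]\backslash 2$, $1b=y$, and $1\notin\{x,y\}$, then $\{xa,ya\}\ne\{x,y\}$; (3) if $z\notin\{1,2\}$ and (3a) $b=[1,y]\backslash z$ (that is, $x=1$) and $y\ne 2$, then $za\ne z$; (3b) $b=[x,y]\backslash z$ and $\{x,y\}=\{1,2\}$, then $|Orb_a(z)|>2$ or $zab\notin\{1,2\}$. Moreover, if $\mathcal A$ is proper and $3$-compressible, then at least one of the words $b^2ab^2$, $b^2a^2b^2$, $b^2a^3b^2$, $b^2abab^2$ $3$-compresses $\mathcal A$.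
   Context: A (semi)automaton is $\mathcal A=(Q,\Sigma,\delta)$ with $Q$ a finite set of states, $\Sigma=\{a,b\}$, and $\delta:Q\times\Sigma\to Q$ total. Words act on states from the right, letter by letter from left to right: $qw$ is the state reached from $q$ by reading $w$ (so $2ab=(2a)b$), and $Qw=\{qw:q\in Q\}$. A word $w$ $3$-compresses $\mathcal A$ if $|Q|-|Qw|\ge 3$; $\mathcal A$ is $3$-compressible if some word $3$-compresses it. A $3$-compressible automaton is proper if no word of length $3$ $3$-compresses it. The letter $a$ is of type $[1,2]\backslash 1$ if $1a=2a$, no other two distinct states have the same image under $a$, and $Q\setminus Qa=\{1\}$. The letter $b$ is of type $[x,y]\backslash z$, also written $b=[x,y]\backslash z$, if $xb=yb$, no other two distinct states have the same image under $b$, and $Q\setminus Qb=\{z\}$; throughout, the first entry in the bracket is the state $x$ with $zb=x$. $Orb_a(q)=\{qa^n:n\ge 0\}$.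
   Formalization: Conditions (2) and (3) are read as also requiring b to have one of the listed forms: (2a), (2b) or (2c) when z=2, and (3a) or (3b) when z is not 1 or 2; with bare implications the ''if'' direction is false. *)

(* Defs.v *)
From mathcomp Require Import all_boot.

Set Implicit Arguments.
Unset Strict Implicit.
Unset Printing Implicit Defensive.

Inductive letter := a | b.

Section Automaton.
Variables (Q : finType) (delta : Q -> letter -> Q).
Implicit Types (p q x y z : Q) (l : letter) (w : seq letter) (k : nat).

(* Words act on the right: act q [:: a; b] is (q a) b. *)
Definition act q w : Q := foldl delta q w.

Definition word_image w : {set Q} := [set act q w | q : Q].

Definition compresses k w : Prop := k <= #|Q| - #|word_image w|.

Definition compressible k : Prop := exists w, compresses k w.

(* Meant for 3-compressible automata; 3-compressibility itself is not part of
   the definition. *)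
Definition proper3 : Prop := forall w, size w = 3 -> ~ compresses 3 w.

(* The letter l is of type [x,y]\z. The requirements that x and y be distinct
   and that z l = x are not included. *)
Definition has_type l x y z : Prop :=
  [/\ delta x l = delta y l,
      forall p q, p <> q -> delta p l = delta q l -> [set p; q] = [set x; y]
    & ~: [set delta q l | q : Q] = [set z]].

Definition Orb l q : {set Q} := [set p | fconnect (delta^~ l) q p].

Lemma OrbP l q p : reflect (exists n, p = act q (nseq n l)) (p \in Orb l q).
Proof.
have actE n r : act r (nseq n l) = iter n (delta^~ l) r.
  by elim: n r => //= n IHn r; rewrite [LHS]IHn -iterSr.
rewrite inE; apply: (iffP idP) => [/iter_findex <- | [n ->]].
  by eexists; rewrite actE.
by rewrite actE fconnect_iter.
Qed.

End Automaton.

(* Main.v *)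
Require Import Defs.
From mathcomp Require Import all_boot.

(** Write 1 and 2 for q1 and q2.  Instead of the images Qw, follow their
    complements, the holes of w: the word w 3-compresses as soon as it has three
    holes.  Let l be of type [x,y]\z and M be the set of holes of w.  The holes
    of wl are z and the states that have all their l-preimages in M.  When M
    misses x and y, these are z and the image of M, one hole more than before.
    When M contains a state p of {x,y}, the common image of x and y is a hole
    only if the other state of {x,y} is in M too, so the holes are z and the
    image of M minus p, as many as before.  Thus the number of holes never
    decreases, and it grows exactly when the present holes avoid the pair that
    the next letter merges ([card_step_disjoint], [card_step_meet]).

    Properness: three letters make three holes only if the second and the third
    both find the present holes disjoint from their pair.  Excluding this for
    aba, abb and bba forces the shapes that the theorem requires of b, and
    these shapes exclude it for all words of length 3 ([proper3E]).

    Compressibility of a proper automaton: two holes form a pair {1,t} after the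
    letter a and a pair {z,u} after the letter b, and a letter that makes no
    third hole merges at one state of the pair and moves the other one.  The
    automaton is 3-compressible if and only if, starting from the holes {z,x}
    of bb, one can reach a pair that misses {1,2} or {x,y}.  If one of the
    conditions on orbits and images fails, the reachable pairs are few and all
    meet both {1,2} and {x,y}: [trap] turns this into a proof that no word makes
    a third hole.  If the conditions hold, start from the pair {1,r} of holes of
    bba; at most two more letters a, or one detour ba, lead to three holes or to
    a pair {1,t} from which bb makes the third hole ([escape]).  Were it not so,
    the injectivity of each letter outside its merged pair would give the
    equalities that the conditions exclude. *)

Set Implicit Arguments.
Unset Strict Implicit.
Unset Printing Implicit Defensive.

(** * Holes of a word *)

Section Holes.
Variables (Q : finType) (delta : Q -> letter -> Q).
Implicit Types (p q t x y z : Q) (l : letter) (w : seq letter) (M N : {set Q}).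

Definition holes w : {set Q} := ~: word_image delta w.

Definition step l M : {set Q} := ~: [set delta q l | q in ~: M].

Lemma stepP l M t :
  reflect (forall q, delta q l = t -> q \in M) (t \in step l M).
Proof.
rewrite inE; apply: (iffP idP) => [tN q qt | tM].
  by apply: contraNT tN => qM; rewrite -qt imset_f // inE.
apply/negP=> /imsetP[q]; rewrite inE => qM /esym qt.
by rewrite tM in qM.
Qed.

Lemma step_mono l M N : M \subset N -> step l M \subset step l N.
Proof. by move=> MN; rewrite setCS imsetS // setCS. Qed.

Lemma holes_rcons w l : holes (rcons w l) = step l (holes w).
Proof.
rewrite /step /holes setCK; congr (~: _); rewrite /word_image -imset_comp.
by apply: eq_imset => q; rewrite /act foldl_rcons.
Qed.

Lemma holesE w : holes w = foldl (fun M l => step l M) set0 w.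
Proof.
elim/last_ind: w => [|w l IHw]; last by rewrite holes_rcons IHw foldl_rcons.
by apply/setP=> q; rewrite !inE; apply/negbF; apply/imsetP; exists q.
Qed.

Lemma compressesE k w : compresses delta k w <-> k <= #|holes w|.
Proof. by rewrite /compresses /holes [in X in _ <-> X]cardsCs setCK. Qed.

(** The number of holes stays below k if the holes always remain inside some
    member of a family of sets of size less than k; inclusion rather than
    equality lets a family member absorb degenerate cases. *)
Lemma not_compressible k (F : {set Q} -> Prop) :
    (exists M, F M) -> (forall M, F M -> #|M| < k) ->
    (forall M l, F M -> exists2 N, F N & step l M \subset N) ->
  ~ compressible delta k.
Proof.
move=> [M0 F0] Fk Fstep [w /compressesE]; apply/negP; rewrite -ltnNge.
suff [M FM hM]: exists2 M, F M & holes w \subset M.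
  exact: leq_ltn_trans (subset_leq_card hM) (Fk _ FM).
elim/last_ind: w => [|w l [M FM hM]]; first by exists M0; rewrite ?holesE ?sub0set.
have [N FN MN] := Fstep M l FM; exists N => //.
by rewrite holes_rcons (subset_trans _ MN) ?step_mono.
Qed.

(** * Effect of one letter on the holes *)

Section OneLetter.
Variables (l : letter) (x y z : Q).
Hypotheses (hl : has_type delta l x y z) (hxy : x <> y).

Lemma type_inj p q : delta p l = delta q l -> q \notin [set x; y] -> p = q.
Proof.
case: hl => _ inj _ pq; case: (eqVneq p q) => // /eqP npq.
by rewrite -(inj p q npq pq) !inE eqxx orbT.
Qed.

(** Deleting one state p of the merged pair from the domain leaves an injective
    map. *)
Lemma type_inj_meet p q r :
  p \in [set x; y] -> q != p -> r != p -> delta q l = delta r l -> q = r.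
Proof.
move=> pxy qp rp qr; case: (boolP (r \in [set x; y])) => [rxy | /(type_inj qr)//].
case: (boolP (q \in [set x; y])) => [qxy | /(type_inj (esym qr))//].
move: pxy qxy rxy qp rp => /set2P[]-> /set2P[]-> /set2P[]->; by rewrite ?eqxx.
Qed.

Lemma type_neq t : delta t l <> z.
Proof.
case: hl => _ _ /setP/(_ (delta t l)) + e.
by rewrite !inE {2}e eqxx imset_f ?inE.
Qed.

Lemma type_notin N : z \notin [set delta q l | q in N].
Proof. by apply/imsetP=> -[q _ /esym/type_neq]. Qed.

Lemma type_onto t : t <> z -> exists q, delta q l = t.
Proof.
case: hl => _ _ /setP/(_ t) + /eqP/negPf tz.
by rewrite !inE tz => /negbFE/imsetP[q _ ->]; exists q.
Qed.

Lemma step_disjoint M :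
  [disjoint M & [set x; y]] -> step l M = z |: [set delta q l | q in M].
Proof.
move=> dM; apply/setP=> t; apply/stepP/setU1P => [tM | [-> q /type_neq// | ]].
  case: (eqVneq t z) => [|/eqP/type_onto[q qt]]; [by left | right].
  by rewrite -qt imset_f ?tM.
case/imsetP=> q qM -> p /type_inj -> //.
by rewrite (disjointFr dM qM).
Qed.

(** The partner of p in {x,y} has the same image as p.  So the image of p is a
    hole only if the partner is in M, and then it is also the image of a state
    of M other than p. *)
Lemma step_meet M p : p \in [set x; y] -> p \in M ->
  step l M = z |: [set delta q l | q in M :\ p].
Proof.
move=> pxy pM; apply/setP=> t; apply/stepP/setU1P => [tM | [-> q /type_neq// | ]].
  case: (eqVneq t z) => [|/eqP/type_onto[q qt]]; [by left | right].
  (* The partner o of p replaces p as a preimage. *)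
  have [o [op oE]]: exists o, o != p /\ delta o l = delta p l.
    case: hl => e _ _; case/set2P: pxy => ->; [exists y | exists x].
      by rewrite eq_sym; split=> //; apply/eqP.
    by split=> //; apply/eqP.
  case: (eqVneq q p) => [qp | qp].
    by rewrite -qt qp -oE imset_f // !inE op tM // oE -qp.
  by rewrite -qt imset_f // !inE qp tM.
case/imsetP=> q /setD1P[qp qM] -> r rq.
case: (eqVneq r p) => [-> // | rp].
by rewrite (type_inj_meet pxy rp qp rq).
Qed.

Lemma card_step_disjoint M : [disjoint M & [set x; y]] -> #|step l M| = #|M|.+1.
Proof.
move=> dM; rewrite step_disjoint // cardsU1 card_in_imset.
  by rewrite type_notin.
by move=> p q pM qM /type_inj; apply; rewrite (disjointFr dM qM).
Qed.

Lemma card_step_meet M p : p \in [set x; y] -> p \in M -> #|step l M| = #|M|.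
Proof.
move=> pxy pM; rewrite (step_meet pxy pM) (cardsD1 p M) pM cardsU1 card_in_imset.
  by rewrite type_notin.
by move=> q r /setD1P[qp _] /setD1P[rp _]; apply: type_inj_meet pxy qp rp.
Qed.

Lemma leq_card_step M : #|M| <= #|step l M| <= #|M|.+1.
Proof.
case: (boolP [disjoint M & [set x; y]]) => [/card_step_disjoint-> |].
  by rewrite leqnSn /=.
by case/pred0Pn=> p /andP[/= pM pxy]; rewrite (card_step_meet pxy pM) leqnn leqnSn.
Qed.

Lemma step0 : step l set0 = [set z].
Proof. by rewrite step_disjoint ?imset0 ?setU0 // disjoints_subset sub0set. Qed.

Lemma step1_disjoint t : t \notin [set x; y] -> step l [set t] = [set z; delta t l].
Proof. by move=> txy; rewrite step_disjoint ?imset_set1 // disjoints1. Qed.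

Lemma step1_meet t : t \in [set x; y] -> step l [set t] = [set z].
Proof.
move=> txy; rewrite (step_meet txy) ?set11 //.
by rewrite setDv imset0 setU0.
Qed.

Lemma step2 p t :
  p \in [set x; y] -> t <> p -> step l [set p; t] = [set z; delta t l].
Proof.
move=> pxy /eqP tp; rewrite (step_meet pxy) ?set21 //.
by rewrite setU1K ?imset_set1 // inE eq_sym.
Qed.

Lemma step2_sub p t :
  p \in [set x; y] -> step l [set p; t] \subset [set z; delta t l].
Proof.
move=> pxy; case: (eqVneq t p) => [-> | /eqP tp]; last by rewrite step2.
by rewrite setUid step1_meet // sub1set set21.
Qed.

Lemma card_step2 p t : p <> t -> p \notin [set x; y] -> t \notin [set x; y] ->
  2 < #|step l [set p; t]|.
Proof.
move=> /eqP pt pxy txy; rewrite card_step_disjoint ?cards2 ?pt //.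
by rewrite -setI_eq0 -subset0; apply/subsetP=> q /setIP[/set2P[] ->];
   rewrite ?(negPf pxy) ?(negPf txy).
Qed.

End OneLetter.
End Holes.

(** * The two letters together *)

Section Pair.
Variables (Q : finType) (delta : Q -> letter -> Q) (q1 q2 x y z : Q).
Hypotheses (hq12 : q1 <> q2) (ha : has_type delta a q1 q2 q1).
Hypotheses (hxy : x <> y) (hxz : x <> z) (hyz : y <> z).
Hypotheses (hb : has_type delta b x y z) (hzb : delta z b = x).
Implicit Types (p q r s t u : Q) (w : seq letter) (M : {set Q}).

Local Notation step := (step delta).
Local Notation holes := (holes delta).

Lemma notin_pair p q t : t <> p -> t <> q -> t \notin [set p; q].
Proof. by move=> /eqP tp /eqP tq; rewrite !inE negb_or tp. Qed.

Lemma eq_q1a_q2a : delta q1 a = delta q2 a.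
Proof. by case: ha. Qed.

Lemma z_notin : z \notin [set x; y].
Proof. by apply: notin_pair => /esym. Qed.

(** z is outside the merged pair, so that x is the image of z only. *)
Lemma b_eq_x t : delta t b = x -> t = z.
Proof. by rewrite -hzb => /(type_inj hb); apply; apply: z_notin. Qed.

Lemma a_inj p q : delta p a = delta q a -> q <> q1 -> q <> q2 -> p = q.
Proof. by move=> /(type_inj ha) + q1N q2N; apply; apply: notin_pair. Qed.

Lemma a_neq t : delta t a <> q1.
Proof. exact: (type_neq ha). Qed.

Lemma step_a p t : p \in [set q1; q2] -> t <> p ->
  step a [set p; t] = [set q1; delta t a].
Proof. exact: (step2 ha). Qed.

Lemma step_b p t : p \in [set x; y] -> t <> p ->
  step b [set p; t] = [set z; delta t b].
Proof. exact: (step2 hb). Qed.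

Lemma step_a_set0 : step a set0 = [set q1].
Proof. exact: step0 ha. Qed.

Lemma step_b_set0 : step b set0 = [set z].
Proof. exact: step0 hb. Qed.

Lemma step_b_z : step b [set z] = [set z; x].
Proof. by rewrite (step1_disjoint hb) ?hzb // z_notin. Qed.

Lemma step_a_q1 : step a [set q1] = [set q1].
Proof. by rewrite (step1_meet ha) // set21. Qed.

Lemma leq_card_step_a M : #|M| <= #|step a M| <= #|M|.+1.
Proof. exact: (leq_card_step ha). Qed.

Lemma leq_card_step_b M : #|M| <= #|step b M| <= #|M|.+1.
Proof. exact: (leq_card_step hb). Qed.

Lemma leq_card_pair p q : #|[set p; q]| <= 2.
Proof. by rewrite cards2; case: (p != q). Qed.

(** The pairs {1,t} with t in T and {z,u} with u in U form a family that is
    closed, up to inclusion, under both letters.  In the last two hypotheses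
    the left alternative merges at 1 or z and moves the other state; the right
    one merges at t or u and moves 1 or z.  Under a the pair {1,t} always
    becomes {1,ta}, and under b the pair {z,u} always becomes {z,zb} = {z,x}. *)
Lemma trap (T U : {set Q}) :
    x \in U -> U \subset [set x; y] ->
    (forall t, t \in T -> delta t a \in T) ->
    (forall u, u \in U -> z \in [set q1; q2] /\ delta u a \in T \/
                          u \in [set q1; q2] /\ delta z a \in T) ->
    (forall t, t \in T -> q1 \in [set x; y] /\ delta t b \in U \/
                          t \in [set x; y] /\ delta q1 b \in U) ->
  ~ compressible delta 3.
Proof.
move=> xU /subsetP Uxy Ta Ua Tb.
pose F M := (exists2 t, t \in T & M = [set q1; t]) \/
            (exists2 u, u \in U & M = [set z; u]).
have suba p t : p \in [set q1; q2] -> delta t a \in T ->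
    exists2 N, F N & step a [set p; t] \subset N.
  move=> pP tT; exists [set q1; delta t a]; last exact: (step2_sub ha hq12).
  by left; exists (delta t a).
have subb p t : p \in [set x; y] -> delta t b \in U ->
    exists2 N, F N & step b [set p; t] \subset N.
  move=> pP tU; exists [set z; delta t b]; last exact: (step2_sub hb hxy).
  by right; exists (delta t b).
apply: (@not_compressible _ _ _ F).
- by exists [set z; x]; right; exists x.
- by move=> M [] [t _ ->]; apply: leq_card_pair.
move=> M [] [] [t tT ->].
- by apply: suba (Ta _ tT); rewrite set21.
- by have [[zP tT'] | [tP zT]] := Ua t tT; [|rewrite setUC]; apply: suba.
- by have [[P tU] | [tP U1]] := Tb t tT; [|rewrite setUC]; apply: subb.
by rewrite setUC; apply: subb; rewrite ?hzb // Uxy.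
Qed.

(** One of aba, abb and bba makes three holes if b has none of these shapes.
    Conversely, these shapes make the second or the third letter of each word
    of length 3 merge at a hole. *)
Lemma proper3E : proper3 delta <->
  (z = q2 -> [\/ x = q1, y = q1 | delta q1 b = y /\ q1 \notin [set x; y]]) /\
  (z \notin [set q1; q2] ->
     (x = q1 /\ y <> q2) \/ [set x; y] = [set q1; q2]).
Proof.
have compr w : proper3 delta -> size w = 3 -> #|holes w| <= 2.
  by move=> pr /pr; rewrite leqNgt => nc; apply/negP=> /compressesE.
split=> [pr | [z2 zN]].
  (* abb: {1}, then {z, 1b}, then a third hole; 1b = x only if z = 1. *)
  have abb : q1 <> z -> q1 \notin [set x; y] -> delta q1 b = y.
    move=> q1z q1P; apply/eqP; apply: contraTT (compr [:: a; b; b] pr erefl).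
    move/eqP=> q1y; rewrite -ltnNge holesE /= step_a_set0 (step1_disjoint hb) //.
    apply: (card_step2 hb); [exact/nesym/(type_neq hb) | exact: z_notin |].
    by apply: notin_pair => // /b_eq_x.
  (* bba: the two holes z and x of bb have to meet {1,2}. *)
  have bba : z \notin [set q1; q2] -> x \in [set q1; q2].
    move=> zP; apply: contraTT (compr [:: b; b; a] pr erefl) => xP.
    by rewrite -ltnNge holesE /= step_b_set0 step_b_z (card_step2 ha) //; apply: nesym.
  split=> [zq2 | zP].
    case: (eqVneq x q1) => [-> | /eqP xq1]; first exact: Or31.
    case: (eqVneq y q1) => [-> | /eqP yq1]; first exact: Or32.
    have q1P : q1 \notin [set x; y] by apply: notin_pair; apply: nesym.
    by apply: Or33; split=> //; apply: abb => //; rewrite zq2.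
  case: (eqVneq y q2) => [yq2 | /eqP yq2].
    right; have:= bba zP; rewrite !inE => /orP[] /eqP xE; rewrite ?xE ?yq2 //.
    by case: hxy; rewrite xE.
  have:= bba zP; rewrite !inE => /orP[] /eqP xE; first by left.
  case: (eqVneq y q1) => [-> | /eqP yq1]; first by right; rewrite xE setUC.
  have q1P : q1 \notin [set x; y].
    by apply: notin_pair; rewrite ?xE //; apply: nesym.
  have q1z : q1 <> z by move=> e; rewrite -e set21 in zP.
  (* Here aba would have the holes z and 1b = y outside {1,2}. *)
  have yE := abb q1z q1P.
  have:= compr [:: a; b; a] pr erefl; rewrite leqNgt holesE /= step_a_set0.
  rewrite (step1_disjoint hb) // yE (card_step2 ha) //; first exact: nesym.
  exact: notin_pair.
have key : z \notin [set q1; q2] -> q1 \in [set x; y].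
  by case/zN=> [[-> _] | ->]; rewrite set21.
(* A letter that merges at one of at most two holes makes no third one. *)
have meet2 l p q s t u : has_type delta l p q s -> p <> q -> t \in [set p; q] ->
    #|step l [set t; u]| <= 2.
  move=> hl pq tP; rewrite (card_step_meet hl pq tP (set21 _ _)).
  exact: leq_card_pair.
have card1 (c : letter) t : #|step c [set t]| <= 2.
  have [_] := andP (leq_card_step_a [set t]).
  by have [_] := andP (leq_card_step_b [set t]); case: c; rewrite cards1.
move=> [|l1 [|l2 [|l3 []]]] //= _ /compressesE; apply/negP.
rewrite -ltnNge ltnS holesE /=.
case: l1; rewrite ?step_a_set0 ?step_b_set0.
  case: l2; rewrite ?step_a_q1 //.
  case: (boolP (q1 \in [set x; y])) => [q1P | q1N].
    by rewrite (step1_meet hb hxy).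
  rewrite (step1_disjoint hb) //; case: l3.
    by apply: (meet2 _ _ _ _ _ _ ha) => //; apply: contraNT q1N => /key.
  rewrite setUC; apply: (meet2 _ _ _ _ _ _ hb) => //.
  have: z \in [set q1; q2] by apply: contraNT q1N => /key.
  case/set2P=> [zq1 | zq2]; first by rewrite -zq1 hzb set21.
  by case: (z2 zq2) q1N => [<-|<-|[-> _]]; rewrite ?set21 ?set22.
case: l2; last first.
  rewrite step_b_z setUC; case: l3; last first.
    by apply: (meet2 _ _ _ _ _ _ hb) => //; rewrite set21.
  case: (boolP (z \in [set q1; q2])) => [zP | zP].
    by rewrite setUC; apply: (meet2 _ _ _ _ _ _ ha).
  apply: (meet2 _ _ _ _ _ _ ha) => //.
  by case: (zN zP) => [[-> _] | <-]; rewrite set21.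
case: (boolP (z \in [set q1; q2])) => [zP | zP].
  by rewrite (step1_meet ha hq12).
rewrite (step1_disjoint ha) //; case: l3.
  by apply: (meet2 _ _ _ _ _ _ ha); rewrite ?set21.
by apply: (meet2 _ _ _ _ _ _ hb); rewrite ?key.
Qed.

(** If 1 is in {x,y}, then b turns {1,t} into {z,tb}, and the next b makes a
    third hole when tb is outside {x,y}; otherwise the first b already makes a
    third hole when t is outside {x,y}.  So this is the condition on t for bb
    to make a third hole from {1,t}. *)
Definition escaping t :=
  if q1 \in [set x; y] then delta t b \notin [set x; y] else t \notin [set x; y].

Lemma escape w t : t <> q1 -> holes w = [set q1; t] -> escaping t ->
  compresses delta 3 (w ++ [:: b; b]).
Proof.
move=> tq1 hw; rewrite /escaping => esc; apply/compressesE.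
rewrite holesE foldl_cat -holesE hw /=.
case: ifPn esc => [q1P tP | q1P tP].
  rewrite step_b // (card_step2 hb _ z_notin) //.
  exact/nesym/(type_neq hb).
have [+ _] := andP (leq_card_step_b (step b [set q1; t])).
by apply: leq_trans; rewrite (card_step2 hb) //; apply: nesym.
Qed.

(** The holes {z,x} of bb meet {1,2}; a merges there and moves the other
    one. *)
Lemma holes_bba r :
    z \in [set q1; q2] /\ r = delta x a \/ x \in [set q1; q2] /\ r = delta z a ->
  holes [:: b; b; a] = [set q1; r].
Proof.
rewrite holesE /= step_b_set0 step_b_z => -[[P ->] | [P ->]].
  by rewrite step_a.
by rewrite setUC step_a //; apply: nesym.
Qed.

Lemma escape_a_power r k : holes [:: b; b; a] = [set q1; r] -> r <> q1 ->
    escaping (iter k (delta^~ a) r) ->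
  compresses delta 3 ([:: b; b; a] ++ nseq k a ++ [:: b; b]).
Proof.
move=> hr rq1; rewrite catA; apply: escape.
  by case: k => //= k; apply: a_neq.
rewrite holesE foldl_cat -holesE hr; elim: k r rq1 {hr} => //= k IHk r rq1.
rewrite step_a ?set21 // IHk; last exact: a_neq.
by rewrite -iterSr.
Qed.

(** The detour through b: {1,r} becomes {z,u} and then {1,ua}. *)
Lemma escape_aba r u : holes [:: b; b; a] = [set q1; r] -> r <> q1 ->
    q1 \in [set x; y] /\ u = delta r b \/ r \in [set x; y] /\ u = delta q1 b ->
    z \in [set q1; q2] -> escaping (delta u a) ->
  compresses delta 3 [:: b; b; a; b; a; b; b].
Proof.
move=> hr rq1 hu zP; apply: (@escape [:: b; b; a; b; a]); first exact: a_neq.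
have uz : u <> z by case: hu => -[_ ->]; apply: (type_neq hb).
rewrite holesE (foldl_cat _ _ [:: b; b; a] [:: b; a]) -holesE hr /=.
suff -> : step b [set q1; r] = [set z; u] by apply: step_a.
case: hu => -[P ->]; first exact: step_b.
by rewrite setUC step_b //; apply: nesym.
Qed.

Lemma Orb_sub l q (S : {set Q}) :
  q \in S -> (forall p, p \in S -> delta p l \in S) -> Orb delta l q \subset S.
Proof.
move=> qS Sl; apply/subsetP=> _ /OrbP[n ->].
elim: n q qS => //= n IHn q qS; exact/IHn/Sl.
Qed.

Lemma Orb_step l q p : p \in Orb delta l q -> delta p l \in Orb delta l q.
Proof.
by rewrite !inE => qp; apply: connect_trans qp (fconnect1 (delta^~ l) p).
Qed.

Lemma Orb_refl l q : q \in Orb delta l q.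
Proof. by rewrite inE. Qed.

(** * Short compressing words *)

Definition short_compressor :=
  [\/ compresses delta 3 [:: b; b; a; b; b],
      compresses delta 3 [:: b; b; a; a; b; b],
      compresses delta 3 [:: b; b; a; a; a; b; b]
    | compresses delta 3 [:: b; b; a; b; a; b; b]].

Lemma escaping_in t : q1 \in [set x; y] ->
  escaping t = (delta t b \notin [set x; y]).
Proof. by rewrite /escaping => ->. Qed.

Lemma escaping_out t : q1 \notin [set x; y] ->
  escaping t = (t \notin [set x; y]).
Proof. by rewrite /escaping => /negPf->. Qed.

Lemma short_power r k : holes [:: b; b; a] = [set q1; r] -> r <> q1 -> k < 3 ->
  escaping (iter k (delta^~ a) r) -> short_compressor.
Proof.
move=> hr rq1 k3 /(escape_a_power hr rq1).
case: k k3 => [|[|[|]]] // _ => h; by [apply: Or41 | apply: Or42 | apply: Or43].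
Qed.

(** The holes of bba^k are 1 and xa^k.  If neither xa nor xaa leaves {x,y},
    then the whole orbit stays there. *)
Lemma short_z_q1 :
  z = q1 -> ~~ (Orb delta a x \subset [set x; y]) -> short_compressor.
Proof.
move=> zq1 orb; have q1N : q1 \notin [set x; y] by rewrite -zq1 z_notin.
have hr : holes [:: b; b; a] = [set q1; delta x a].
  by apply: holes_bba; left; rewrite zq1 set21.
have esc k := @short_power _ k hr (@a_neq _).
case: (boolP (delta x a \in [set x; y])) => [|xaN]; last first.
  by apply: (esc 0) => //; rewrite escaping_out.
case/set2P=> xa.
  case/negP: orb; apply: subset_trans (subsetUl _ _).
  by apply: Orb_sub (set11 x) _ => p /set1P->; rewrite xa set11.
apply: (esc 1) => //; rewrite escaping_out //= xa.
apply: contra orb => ya; apply: Orb_sub (set21 _ _) _ => p /set2P[]-> //.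
by rewrite xa set22.
Qed.

(** With p = 2a, the holes of bba are 1 and p.  The hypothesis excludes p = 2,
    so that bbabb works unless pb = y.  In that case bbaabb works if pa <> 2, and
    bbababb works if pa = 2: the state pa or ya that is then paired with 1 is
    sent by b neither to 1 = 2b nor to y = pb, by the injectivity of both
    letters outside their pairs and, when p = y, by the hypothesis on the
    orbit. *)
Lemma short_z_q2_x_q1 : z = q2 -> x = q1 ->
    ~~ (Orb delta a q2 \subset [set q2; y]) \/
      delta (delta q2 a) b \notin [set q1; y] ->
  short_compressor.
Proof.
move=> zq2 xq1; set p := delta q2 a => orb.
have q1P : q1 \in [set x; y] by rewrite xq1 set21.
have yq1 : y <> q1 by rewrite -xq1; apply: nesym.
have yq2 : y <> q2 by rewrite -zq2.
have p1 : p <> q1 by apply: a_neq.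
have hr : holes [:: b; b; a] = [set q1; p].
  by apply: holes_bba; left; rewrite zq2 set22 xq1 /p -eq_q1a_q2a.
have esc k := @short_power _ k hr p1.
case: (boolP (escaping p)) => [|]; first exact: (esc 0).
rewrite escaping_in // negbK xq1 => pbP.
have {}orb : ~~ (Orb delta a q2 \subset [set q2; y]).
  by case: orb => //; rewrite pbP.
have pq2 : p <> q2.
  move=> pq2; case/negP: orb; apply: subset_trans (subsetUl _ _).
  by apply: Orb_sub (set11 q2) _ => t /set1P->; rewrite -/p pq2 set11.
have pb : delta p b = y.
  by case/set2P: pbP => // e; case: pq2; rewrite -zq2; apply: b_eq_x; rewrite xq1.
have y_eq t : delta t b = y -> p <> y -> t = p.
  by rewrite -{1}pb => /(type_inj hb) + py; apply; rewrite xq1; apply: notin_pair.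
case: (eqVneq (delta p a) q2) => [pa | /eqP pa].
  (* The holes of bbab are 2 and y. *)
  have py : p <> y.
    move=> py; case/negP: orb; apply: Orb_sub (set21 _ _) _ => t /set2P[]->.
      by rewrite -/p py set22.
    by rewrite -py pa set21.
  apply: Or44; apply: (@escape_aba _ y hr) => //.
  - by left.
  - by rewrite zq2 set22.
  rewrite escaping_in //; apply: notin_pair.
    by move=> /b_eq_x; rewrite zq2 -pa => /esym /a_inj yp; apply: py; rewrite yp.
  by move/y_eq=> /(_ py) yap; apply/yq2/esym/a_inj; rewrite ?yap.
apply: (esc 1) => //; rewrite escaping_in //=; apply: notin_pair.
  by move/b_eq_x; rewrite zq2.
move=> pab; case: (eqVneq p y) => [py | /eqP py]; last first.
  by apply: (pq2); apply/esym; apply: a_inj => //; rewrite (y_eq _ pab py).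
have yaN : delta y a \notin [set q2; y].
  apply: contra orb => ya; apply: Orb_sub (set21 _ _) _ => t /set2P[]-> //.
  by rewrite -/p py set22.
have: p = delta p a.
  apply: (type_inj hb); rewrite ?pab ?pb // xq1; apply: notin_pair; first exact: a_neq.
  by rewrite py => e; rewrite e set22 in yaN.
by rewrite {1}py => e; rewrite -py -e py set22 in yaN.
Qed.

(** The holes of bba are 1 and t = xa, and bbabb works unless tb = x, that is
    t = 2, or tb = 1.  When t = 2, one or two more letters a are enough.  When
    tb = 1, the pair {2,1} after bbab leads to {1,2a}, from which bb makes a
    third hole unless 2a = 2; in that last case bbaabb works. *)
Lemma short_z_q2_y_q1 : z = q2 -> y = q1 ->
    [set delta q2 a; delta x a] <> [set q2; x] \/
    [set delta (delta q2 a) b; delta (delta x a) b] <> [set q1; x] ->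
  short_compressor.
Proof.
move=> zq2 yq1 cond; set t := delta x a.
have q1P : q1 \in [set x; y] by rewrite yq1 set22.
have xq1 : x <> q1 by rewrite -yq1.
have xq2 : x <> q2 by rewrite -zq2.
have q2b : delta q2 b = x by rewrite -zq2.
have t1 : t <> q1 by apply: a_neq.
have hr : holes [:: b; b; a] = [set q1; t].
  by apply: holes_bba; left; rewrite zq2 set22.
have esc k := @short_power _ k hr t1.
have y_eq r s : delta r b = q1 -> delta s b = q1 -> r <> q1 -> r <> x -> s = r.
  move=> rb sb r1 rx; apply: (type_inj hb); first by rewrite rb.
  by rewrite yq1; apply: notin_pair.
case: (boolP (escaping t)) => [|]; first exact: (esc 0).
rewrite escaping_in // negbK yq1 => /set2P[/b_eq_x | tb].
  rewrite zq2 => tq2; set s := delta q2 a.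
  have sq2 : s <> q2 by rewrite -tq2 => /a_inj e; apply/xq2/esym/e.
  case: (boolP (escaping s)) => [|]; first by rewrite /s -tq2; apply: (esc 1).
  rewrite escaping_in // negbK yq1 => /set2P[/b_eq_x | sb]; first by rewrite zq2.
  have sx : s <> x.
    move=> sx; case: cond => -[]; rewrite -/s -/t tq2 sx.
      by rewrite setUC.
    by rewrite -{1}sx sb q2b.
  have s1 : s <> q1 by apply: a_neq.
  apply: (esc 2) => //=; rewrite tq2 -/s escaping_in // yq1; apply: notin_pair.
    by move/b_eq_x; rewrite zq2 -tq2 => /esym/a_inj e; apply: sx; rewrite e.
  by move/(y_eq s)=> /(_ sb s1 sx) sas; apply: (sq2); apply/esym/a_inj => //.
have tq2 : t <> q2 by move=> e; rewrite e q2b in tb.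
case: (eqVneq (delta q2 a) q2) => [q2a | /eqP q2a]; last first.
  apply: Or44; apply: (@escape_aba _ q1 hr) => //; first by left.
    by rewrite zq2 set22.
  rewrite escaping_in // yq1 eq_q1a_q2a; apply: notin_pair.
    by move/b_eq_x; rewrite zq2.
  move=> sb; have st : delta q2 a <> t by move=> /a_inj e; apply/xq2/esym/e.
  case: (eqVneq (delta q2 a) x) => [sx | /eqP sx].
    by apply: (st); apply: y_eq tb sb t1 _; rewrite -sx; apply: nesym.
  by apply: (st); apply/esym; apply: y_eq sb tb (@a_neq _) sx.
apply: (esc 1) => //=; rewrite escaping_in // yq1; apply: notin_pair.
  move/b_eq_x; rewrite zq2 => ta; apply: (tq2); apply/esym/a_inj => //.
  by rewrite q2a.
move=> tab; case: (eqVneq t x) => [tx | /eqP tx].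
  case: cond => -[]; rewrite q2a -/t tx //.
  by rewrite q2b -{2}tx tb setUC.
have ta : delta t a = t by apply: y_eq tb tab t1 tx.
by apply: (tx); apply: a_inj; rewrite ?ta.
Qed.

(** As a is injective on {x,y}, the last hypothesis says that xa or ya is
    outside {x,y}.  The pair {1,xa} of holes of bba leads to {1,ya} directly if
    xa = y, and through {z,1b} = {z,y} if xa = x. *)
Lemma short_z_q2_q1b_y : z = q2 -> delta q1 b = y -> q1 \notin [set x; y] ->
    [set delta x a; delta y a] <> [set x; y] ->
  short_compressor.
Proof.
move=> zq2 q1b q1N cond.
have hr : holes [:: b; b; a] = [set q1; delta x a].
  by apply: holes_bba; left; rewrite zq2 set22.
have yq2 : y <> q2 by rewrite -zq2.
have yq1 : y <> q1 by move=> e; rewrite -e set22 in q1N.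
have esc k := @short_power _ k hr (@a_neq _).
case: (boolP (delta x a \in [set x; y])) => [xaP | xaN]; last first.
  by apply: (esc 0) => //; rewrite escaping_out.
have yaN : delta y a \notin [set x; y].
  apply/negP=> yaP; apply: cond.
  have: delta x a <> delta y a by move=> /a_inj; auto.
  by move: xaP yaP => /set2P[]-> /set2P[]-> //; rewrite setUC.
case/set2P: (xaP) => xa; last by apply: (esc 1) => //; rewrite escaping_out //= xa.
apply: Or44; apply: (@escape_aba _ y hr); rewrite ?escaping_out ?zq2 ?set22 //.
  exact: a_neq.
by right.
Qed.

(** The holes of bba are 1 and t = za.  If bbabb fails, then tb = y, so bbab
    has the holes z and y, both outside {1,2}, and a makes the third one. *)
Lemma short_x_q1 :
    z \notin [set q1; q2] -> x = q1 -> y <> q2 -> delta z a <> z ->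
  short_compressor.
Proof.
move=> zP xq1 yq2 zaz; set t := delta z a.
have q1P : q1 \in [set x; y] by rewrite xq1 set21.
have t1 : t <> q1 by apply: a_neq.
have hr : holes [:: b; b; a] = [set q1; t].
  by apply: holes_bba; right; rewrite xq1 set21.
case: (boolP (escaping t)) => [|]; first exact: (@short_power _ 0).
rewrite escaping_in // negbK => /set2P[/b_eq_x // | tb].
apply: Or44; apply/compressesE.
rewrite holesE (foldl_cat _ _ [:: b; b; a] [:: b; a; b; b]) -holesE hr /=.
rewrite step_b // tb.
have h3 : 2 < #|step a [set z; y]|.
  rewrite (card_step2 ha) //; first exact: nesym.
  by apply: notin_pair; rewrite // -xq1; apply: nesym.
have [h4 _] := andP (leq_card_step_b (step a [set z; y])).
have [h5 _] := andP (leq_card_step_b (step b (step a [set z; y]))).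
exact: leq_trans h3 (leq_trans h4 h5).
Qed.

(** The holes of bba^k are 1 and za^k.  If bbabb fails and the orbit of z has
    at least three states, then zab = y, and zaab is neither x, since zaa <> z,
    nor y, since za and zaa are distinct and both different from 1. *)
Lemma short_xy_q12 : z \notin [set q1; q2] -> [set x; y] = [set q1; q2] ->
    2 < #|Orb delta a z| \/ delta (delta z a) b \notin [set q1; q2] ->
  short_compressor.
Proof.
move=> zP xyE cond; set t := delta z a.
have q1P : q1 \in [set x; y] by rewrite xyE set21.
have xP : x \in [set q1; q2] by rewrite -xyE set21.
have t1 : t <> q1 by apply: a_neq.
have hr : holes [:: b; b; a] = [set q1; t] by apply: holes_bba; right.
have esc k := @short_power _ k hr t1.
case: (boolP (escaping t)) => [|]; first exact: (esc 0).
rewrite escaping_in // negbK => tbP.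
have {cond} orb : 2 < #|Orb delta a z|.
  by case: cond => //; rewrite -xyE tbP.
have orbN p : p \in [set z; t] -> delta t a <> p.
  move=> pP tap; move: orb; rewrite ltnNge; case/negP.
  apply: leq_trans (leq_card_pair z t); apply: subset_leq_card.
  apply: Orb_sub (set21 _ _) _ => r /set2P[]->; rewrite ?set22 //.
  by rewrite tap.
apply: (esc 1) => //=; rewrite escaping_in //; apply: notin_pair.
  by move/b_eq_x; apply: orbN; rewrite set21.
have tb : delta t b = y.
  case/set2P: tbP => // /b_eq_x tz; case: (orbN z); rewrite ?set21 //.
  by rewrite tz.
have tat : delta t a <> t by apply: orbN; rewrite set22.
move=> tab; have e := etrans tab (esym tb).
case: (boolP (t \in [set x; y])) => [|/(type_inj hb e) //].
case: (boolP (delta t a \in [set x; y])) => [|/(type_inj hb (esym e))/esym //].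
rewrite xyE => /set2P[/a_neq //|ta] /set2P[// | t2].
by apply: tat; rewrite ta.
Qed.

(** * Traps when a condition fails *)

Hypothesis compressible3 : compressible delta 3.

Lemma compressible_z_q1 : z = q1 -> ~~ (Orb delta a x \subset [set x; y]).
Proof.
move=> zq1; apply/negP=> /subsetP orb; move: compressible3.
apply: (@trap (Orb delta a x) [set x]); rewrite ?set11 ?sub1set ?set21 //.
- exact: Orb_step.
- by move=> u /set1P->; left; rewrite zq1 set21; split; rewrite ?Orb_step ?Orb_refl.
- by move=> t /orb; right; rewrite -zq1 hzb set11.
Qed.

(** The trap consists of the pairs {1,t} with t in the orbit of 2, which is
    {2} or {2,y}, and {2,u} with u in {1,y}.  The pair {2,y} is allowed only if
    ya is in that orbit, which holds as soon as the pair is reached. *)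
Lemma compressible_z_q2_x_q1 : z = q2 -> x = q1 ->
  ~~ (Orb delta a q2 \subset [set q2; y]) \/
    delta (delta q2 a) b \notin [set q1; y].
Proof.
move=> zq2 xq1; apply/orP; rewrite -negb_and; apply/negP=> /andP[orb q2ab].
move: compressible3.
pose U := [set u in [set x; y] | delta u a \in Orb delta a q2].
apply: (@trap (Orb delta a q2) U).
- by rewrite inE set21 xq1 eq_q1a_q2a Orb_step ?Orb_refl.
- by apply/subsetP=> u; rewrite inE => /andP[].
- exact: Orb_step.
- by move=> u; rewrite inE zq2 set22 => /andP[_ ?]; left.
move=> t tO; left; rewrite -xq1 set21; split=> //; rewrite inE.
have xa : delta x a \in Orb delta a q2.
  by rewrite xq1 eq_q1a_q2a Orb_step ?Orb_refl.
move: (subsetP orb t tO) => /set2P[tE|tE]; first by rewrite tE -{1 2}zq2 hzb set21.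
rewrite tE in tO *.
(* y is in the orbit of 2, and 2a = 2 would make this orbit {2}. *)
have q2a : delta q2 a = y.
  have: delta q2 a \in [set q2; y] by apply: (subsetP orb); rewrite Orb_step ?Orb_refl.
  case/set2P=> // q2a; have /subsetP/(_ y tO): Orb delta a q2 \subset [set q2].
    by apply: Orb_sub => [|p /set1P->]; rewrite ?q2a set11.
  by move/set1P; rewrite -zq2 => /hyz.
by move: q2ab; rewrite q2a -xq1 => /set2P[]->; rewrite ?set21 ?set22 ?xa // Orb_step.
Qed.

Lemma compressible_z_q2_y_q1 : z = q2 -> y = q1 ->
  [set delta q2 a; delta x a] <> [set q2; x] \/
  [set delta (delta q2 a) b; delta (delta x a) b] <> [set q1; x].
Proof.
move=> zq2 yq1.
case: (eqVneq [set delta q2 a; delta x a] [set q2; x]) => [aE | /eqP]; last by left.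
case: (eqVneq [set delta (delta q2 a) b; delta (delta x a) b] [set q1; x]);
  last by move/eqP; right.
move=> bE; case: (@trap [set q2; x] [set q1; x]) => //.
- exact: set22.
- by rewrite yq1 setUC.
- by move=> t /set2P[]->; rewrite -aE ?set21 ?set22.
- by move=> u /set2P[]->; left; rewrite zq2 set22 ?eq_q1a_q2a -aE ?set21 ?set22.
move=> t tT; left; rewrite yq1 set22; split=> //.
have b_image p q : [set delta p b; delta q b] = [set delta r b | r in [set p; q]].
  by rewrite imsetU !imset_set1.
by rewrite -bE b_image aE imset_f.
Qed.

Lemma compressible_z_q2_q1b_y : z = q2 -> delta q1 b = y ->
  [set delta x a; delta y a] <> [set x; y].
Proof.
move=> zq2 q1b aE; move: compressible3.
have aP t : t \in [set x; y] -> delta t a \in [set x; y].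
  by case/set2P=> ->; rewrite -aE ?set21 ?set22.
apply: (@trap [set x; y] [set x; y]); rewrite ?set21 //.
- by move=> u /aP; left; rewrite zq2 set22.
- by move=> t tP; right; rewrite q1b set22.
Qed.

Lemma compressible_x_q1 : x = q1 -> delta z a <> z.
Proof.
move=> xq1 za; move: compressible3.
apply: (@trap [set z] [set x]); rewrite ?set11 ?sub1set ?set21 //.
- by move=> t /set1P->; rewrite za set11.
- by move=> u /set1P->; right; rewrite xq1 za set21 set11.
- by move=> t /set1P->; left; rewrite -xq1 hzb set21 set11.
Qed.

Lemma compressible_xy_q12 : [set x; y] = [set q1; q2] ->
  2 < #|Orb delta a z| \/ delta (delta z a) b \notin [set q1; q2].
Proof.
move=> xyE; apply/orP; rewrite -implyNb -leqNgt; apply/implyP=> orb.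
apply/negP=> zab; move: compressible3.
apply: (@trap (Orb delta a z) [set x; y]); rewrite ?set21 //.
- exact: Orb_step.
- by move=> u; rewrite xyE => uP; right; rewrite Orb_step ?Orb_refl.
move=> t tO; left; rewrite [in X in X /\ _]xyE set21; split=> //.
have [za | /eqP za] := eqVneq (delta z a) z.
  have /subsetP/(_ t tO)/set1P->: Orb delta a z \subset [set z].
    by apply: Orb_sub => [|p /set1P->]; rewrite ?za set11.
  by rewrite hzb set21.
have sub : [set z; delta z a] \subset Orb delta a z.
  by apply/subsetP=> p /set2P[]->; rewrite ?Orb_step ?Orb_refl.
have /eqP orbE : [set z; delta z a] == Orb delta a z.
  by rewrite eqEcard sub cards2; move/eqP/negPf: za; rewrite eq_sym => ->.
by move: tO; rewrite -orbE => /set2P[]->; rewrite ?hzb ?set21 // xyE.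
Qed.

End Pair.

(** * The characterization *)

Theorem proposition22 (Q : finType) (delta : Q -> letter -> Q)
    (q1 q2 x y z : Q)
    (hq12 : q1 <> q2)
    (ha : has_type delta a q1 q2 q1)
    (hxy : x <> y) (hxz : x <> z) (hyz : y <> z)
    (hb : has_type delta b x y z)
    (hzb : delta z b = x) :
  ((proper3 delta /\ compressible delta 3) <->
   [/\ (* (1) *)
       z = q1 -> ~~ (Orb delta a x \subset [set x; y]),
       (* (2) *)
       z = q2 ->
       [/\ (* b has one of the forms listed in (2a), (2b), (2c) *)
           [\/ x = q1, y = q1
             | delta q1 b = y /\ q1 \notin [set x; y]],
           (* (2a) *)
           x = q1 ->
             ~~ (Orb delta a q2 \subset [set q2; y]) \/
             act delta q2 [:: a; b] \notin [set q1; y],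
           (* (2b) *)
           y = q1 ->
             [set delta q2 a; delta x a] <> [set q2; x] \/
             [set act delta q2 [:: a; b]; act delta x [:: a; b]]
               <> [set q1; x]
         & (* (2c) *)
           delta q1 b = y -> q1 \notin [set x; y] ->
             [set delta x a; delta y a] <> [set x; y]]
     & (* (3) *)
       z \notin [set q1; q2] ->
       [/\ (* b has one of the forms listed in (3a), (3b) *)
           (x = q1 /\ y <> q2) \/ [set x; y] = [set q1; q2],
           (* (3a) *)
           x = q1 -> y <> q2 -> delta z a <> z
         & (* (3b) *)
           [set x; y] = [set q1; q2] ->
             2 < #|Orb delta a z| \/
             act delta z [:: a; b] \notin [set q1; q2]]])
  /\
  (proper3 delta /\ compressible delta 3 ->
   [\/ compresses delta 3 [:: b; b; a; b; b],
       compresses delta 3 [:: b; b; a; a; b; b],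
       compresses delta 3 [:: b; b; a; a; a; b; b]
     | compresses delta 3 [:: b; b; a; b; a; b; b]]).
Proof.
set conditions := [/\ _, _ & _].
have prE := proper3E hq12 ha hxy hxz hyz hb hzb.
have necessary : proper3 delta /\ compressible delta 3 -> conditions.
  case=> /prE[forms2 forms3] comp; split.
  - exact: (compressible_z_q1 hq12 ha hxy hb hzb comp).
  - move=> zq2; split; first exact: forms2.
    + exact: (compressible_z_q2_x_q1 hq12 ha hxy hyz hb hzb comp zq2).
    + exact: (compressible_z_q2_y_q1 hq12 ha hxy hb hzb comp zq2).
    + by move=> q1b _; apply: (compressible_z_q2_q1b_y hq12 ha hxy hb hzb comp zq2).
  - move=> zP; split; first exact: forms3.
    + by move=> xq1 _; apply: (compressible_x_q1 hq12 ha hxy hb hzb comp).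
    + exact: (compressible_xy_q12 hq12 ha hxy hb hzb comp).
have short : conditions -> short_compressor delta.
  case=> c1 c2 c3.
  case: (eqVneq z q1) => [zq1 | /eqP zq1].
    exact: (short_z_q1 hq12 ha hxy hxz hyz hb hzb zq1 (c1 zq1)).
  case: (eqVneq z q2) => [zq2 | /eqP zq2].
    case: (c2 zq2) => -[xq1 | yq1 | [q1b q1N]] ca cb cc.
    - exact: (short_z_q2_x_q1 hq12 ha hxy hxz hyz hb hzb zq2 xq1 (ca xq1)).
    - exact: (short_z_q2_y_q1 hq12 ha hxy hxz hyz hb hzb zq2 yq1 (cb yq1)).
    - exact: (short_z_q2_q1b_y hq12 ha hxy hxz hyz hb hzb zq2 q1b q1N (cc q1b q1N)).
  have zP : z \notin [set q1; q2] by apply: notin_pair.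
  case: (c3 zP) => -[[xq1 yq2] | xyE] ca cb.
    exact: (short_x_q1 hq12 ha hxy hxz hyz hb hzb zP xq1 yq2 (ca xq1 yq2)).
  exact: (short_xy_q12 hq12 ha hxy hxz hyz hb hzb zP xyE (cb xyE)).
split; last by move/necessary/short.
split=> [| cond]; first exact: necessary.
split; last by case: (short cond) => h; eexists; apply: h.
apply/prE; case: cond => _ c2 c3.
by split=> [/c2[] | /c3[]].
Qed.
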